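(* Let $(W,S)$ be a finite Coxeter system. Let $\mathrm{LL}(W)$ denote the Loewy length of the Solomon descent algebra $\Sigma(W)$, and let $\mathrm{LL}(W,\sigma_0)$ denote the Loewy length of the subalgebra $\Sigma(W)^{\sigma_0}$ of fixed points of $\sigma_0$ in $\Sigma(W)$, where $\sigma_0$ is the automorphism induced by conjugation by the longest element $w_0$ of $W$. Then: (a) $\mathrm{LL}(W)\le |S|$. (b) $\mathrm{LL}(W,\sigma_0)\le \frac{|S|+1}{2}$.
   Context: Let $(W,S)$ be a finite Coxeter system with length function $\ell$. For $I\subset S$, set $X_I=\{w\in W : \ell(ws)>\ell(w)\ \text{for all } s\in I\}$ and $x_I=\sum_{w\in X_I} w\in\mathbb{Q}W$. The Solomon descent algebra is $\Sigma(W)=\bigoplus_{I\subset S}\mathbb{Q}x_I$; it is a unital subalgebra of the group algebra $\mathbb{Q}W$, with basis $(x_I)_{I\subset S}$ (Solomon). The automorphism $\sigma_0$ of $W$, $w\mapsto w_0ww_0^{-1}$, satisfies $\sigma_0(S)=S$, so it induces an algebra automorphism of $\Sigma(W)$, still denoted $\sigma_0$ (with $\sigma_0(x_I)=x_{\sigma_0(I)}$). The Loewy length of a finite dimensional algebra $A$ is the smallest natural number $k\ge 1$ such that $(\mathrm{Rad}\,A)^k=0$, where $\mathrm{Rad}\,A$ is the radical of $A$.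
   Formalization: The formal theorem assumes that S is nonempty; for S empty, W is trivial, the descent algebra is Q, its Loewy length is 1 by the convention k ≥ 1, and both bounds (1 ≤ 0 and 1 ≤ 1/2) fail. *)

(* Defs.v *)
From HB Require Import structures.
From mathcomp Require Import all_boot all_order all_algebra all_fingroup all_field.

Set Implicit Arguments.
Unset Strict Implicit.
Unset Printing Implicit Defensive.

Import GRing.Theory.
Local Open Scope ring_scope.

(* The group algebra QW, as functions W -> Q under convolution.  The alias
   hides the pointwise product that {ffun _ -> _} carries in the library. *)
Definition galg (W : finGroupType) : Type := {ffun W -> rat^o}.

Section GroupAlgebra.
Variable W : finGroupType.

HB.instance Definition _ := Vector.copy (galg W) {ffun W -> rat^o}.

Implicit Types a b c : galg W.

Definition gelt (w : W) : galg W := [ffun v => (v == w)%:R].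

Definition gmul a b : galg W := [ffun w => \sum_u a u * b (u^-1 * w)%g].

Fact gmulA : associative gmul.
Proof.
move=> a b c; apply/ffunP=> w; rewrite !ffunE.
under eq_bigr => u _ do rewrite ffunE mulr_sumr.
under [RHS]eq_bigr => u _ do rewrite ffunE mulr_suml.
rewrite [RHS]exchange_big; apply: eq_bigr => u _ /=.
rewrite [RHS](reindex_inj (mulgI u)); apply: eq_bigr => v _ /=.
by rewrite mulKg invMg !mulgA mulrA.
Qed.

Fact gmul1l : left_id (gelt 1%g) gmul.
Proof.
move=> a; apply/ffunP=> w; rewrite ffunE (bigD1 1%g) //= big1 => [|u nu].
  by rewrite ffunE eqxx mul1r addr0 invg1 mul1g.
by rewrite ffunE (negPf nu) mul0r.
Qed.

Fact gmul1r : right_id (gelt 1%g) gmul.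
Proof.
move=> a; apply/ffunP=> w; rewrite ffunE (bigD1 w) //= big1 => [|u nu].
  by rewrite ffunE mulVg eqxx mulr1 addr0.
by rewrite ffunE -eq_invg_mul invgK (negPf nu) mulr0.
Qed.

Fact gmulDl : left_distributive gmul +%R.
Proof.
move=> a b c; apply/ffunP=> w; rewrite !ffunE -big_split.
by apply: eq_bigr => u _; rewrite ffunE mulrDl.
Qed.

Fact gmulDr : right_distributive gmul +%R.
Proof.
move=> a b c; apply/ffunP=> w; rewrite !ffunE -big_split.
by apply: eq_bigr => u _; rewrite ffunE mulrDr.
Qed.

Fact gelt1_neq0 : gelt 1%g != 0.
Proof.
by apply/eqP=> /ffunP/(_ 1%g)/eqP; rewrite !ffunE eqxx oner_eq0.
Qed.

HB.instance Definition _ := GRing.Zmodule_isNzRing.Build (galg W)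
  gmulA gmul1l gmul1r gmulDl gmulDr gelt1_neq0.

Fact gscaleAl (k : rat) a b : k *: (a * b) = (k *: a) * b.
Proof.
apply/ffunP=> w; rewrite !ffunE scaler_sumr.
by apply: eq_bigr => u _; rewrite ffunE scalerAl.
Qed.

HB.instance Definition _ :=
  GRing.Lmodule_isLalgebra.Build rat (galg W) gscaleAl.

Fact gscaleAr (k : rat) a b : k *: (a * b) = a * (k *: b).
Proof.
apply/ffunP=> w; rewrite !ffunE scaler_sumr.
by apply: eq_bigr => u _; rewrite ffunE scalerAr.
Qed.

HB.instance Definition _ :=
  GRing.Lalgebra_isAlgebra.Build rat (galg W) gscaleAr.
HB.instance Definition _ := Algebra_isFalgebra.Build rat (galg W).

Lemma gelt1 : gelt 1%g = 1. Proof. by []. Qed.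

Lemma geltM u v : gelt (u * v)%g = gelt u * gelt v.
Proof.
apply/ffunP=> w; rewrite !ffunE (bigD1 u) //= big1 => [|x nx].
  by rewrite !ffunE eqxx mul1r addr0 (can2_eq (mulKVg u) (mulKg u)).
by rewrite ffunE (negPf nx) mul0r.
Qed.

Lemma galg_sumE a : a = \sum_w a w *: gelt w.
Proof.
apply/ffunP=> w; rewrite sum_ffunE (bigD1 w) //= big1 => [|u nu].
  by rewrite !ffunE eqxx addr0 [RHS]mulr1.
by rewrite !ffunE eq_sym (negPf nu) scaler0.
Qed.

Definition galg_map (f : W -> W) a : galg W := \sum_w a w *: gelt (f w).

Fact galg_map_is_linear f : linear (galg_map f).
Proof.
move=> k a b; rewrite /galg_map scaler_sumr -big_split /=.
by apply: eq_bigr => w _; rewrite !ffunE scalerDl scalerA.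
Qed.

HB.instance Definition _ f :=
  GRing.isLinear.Build rat (galg W) (galg W) _ (galg_map f)
    (galg_map_is_linear f).

Lemma galg_map_gelt f w : galg_map f (gelt w) = gelt (f w).
Proof.
rewrite /galg_map (bigD1 w) //= big1 => [|u nu].
  by rewrite ffunE eqxx scale1r addr0.
by rewrite ffunE (negPf nu) scale0r.
Qed.

End GroupAlgebra.

Section Coxeter.
Variables (W : finGroupType) (S : {set W}).

(* W = < S | (s t)^{m(s,t)} = 1 > with m(s,t) the order of s t (so m(s,s) = 1),
   the presentation being expressed by its universal property. *)
Definition coxeter_system : Prop :=
  [/\ <<S>>%g = [set: W],
      forall s, s \in S -> #[s]%g = 2%N
    & forall (H : groupType) (f : W -> H),
        (forall s t, s \in S -> t \in S ->
           ((f s * f t) ^+ #[(s * t)%g] = 1)%g) ->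
        exists2 phi : W -> H,
          forall u v, phi (u * v)%g = (phi u * phi v)%g
        & {in S, phi =1 f}].

(* (S ^+ n)%g is the set of products of n elements of S.  Lengths are at most
   #|W|, since the successive partial products of a shortest word are distinct;
   on elements outside <<S>> the value is irrelevant. *)
Definition coxlen (w : W) : nat :=
  find (fun n => w \in (S ^+ n)%g) (iota 0 #|W|.+1).

Definition minrep (I : {set W}) : {set W} :=
  [set w | [forall s in I, (coxlen w < coxlen (w * s)%g)%N]].

Definition xelt (I : {set W}) : galg W := \sum_(w in minrep I) gelt w.

Definition descent_algebra : {vspace galg W} :=
  <<[seq xelt J | J <- enum (powerset S)]>>%VS.

Definition longest : W := [arg max_(w > 1%g) coxlen w].

Definition sigma0 : 'End(galg W) :=
  linfun (galg_map (fun w => longest * w * longest^-1)%g).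

Definition descent_algebra_fixed : {vspace galg W} :=
  (descent_algebra :&: fixedSpace sigma0)%VS.

Lemma mem_expset (A : {set W}) n w :
  reflect (exists2 c : seq W, size c = n /\ {subset c <= A}
                            & w = (\prod_(x <- c) x)%g)
          (w \in (A ^+ n)%g).
Proof.
elim: n w => [|n IHn] w.
  rewrite expg0 inE; apply: (iffP eqP) => [->|[c [/size0nil-> _] ->]].
    by exists [::]; rewrite ?big_nil.
  by rewrite big_nil.
rewrite expgS; apply: (iffP mulsgP) => [[x y Ax /IHn[c [sz cA] ->] ->]|].
  exists (x :: c); last by rewrite big_cons.
  by split=> [|z]; rewrite /= ?sz // inE => /predU1P[->|/cA].
case=> [[|x c] [] //= [sz] cA ->]; rewrite big_cons.
exists x (\prod_(y <- c) y)%g => //; first by rewrite cA ?mem_head.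
by apply/IHn; exists c => //; split=> // z cz; rewrite cA // inE cz orbT.
Qed.

Lemma gen_expset w : w \in <<S>>%g -> exists n, w \in (S ^+ n)%g.
Proof.
case/gen_prodgP=> n [c cS ->]; exists n; apply/mem_expset.
exists [seq c i | i <- enum 'I_n]; last by rewrite big_map enumT.
by rewrite size_map size_enum_ord; split=> // x /mapP[i _ ->].
Qed.

Lemma expset_short w n : w \in (S ^+ n)%g ->
  (forall m, (m < n)%N -> w \notin (S ^+ m)%g) -> (n <= #|W|)%N.
Proof.
case/mem_expset=> c [sz cS] -> minn; rewrite leqNgt; apply/negP=> ltWn.
pose p (i : 'I_n) := (\prod_(x <- take i c) x)%g.
have /injectivePn[i [j nij eqp]] : ~~ injectiveb p.
  apply/injectiveP=> /leq_card; rewrite card_ord leqNgt.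
  by rewrite ltWn.
wlog ltij : i j nij eqp / (i < j)%N => [IH|].
  have [ltij|] := ltnP i j; first exact: (IH i j).
  rewrite leq_eqVlt => /predU1P[/val_inj eji|]; first by rewrite eji eqxx in nij.
  by apply: IH; rewrite // eq_sym.
pose d := take i c ++ drop j c.
have szd : size d = (i + (n - j))%N.
  by rewrite size_cat size_takel ?size_drop ?sz // ltnW.
have ltd : (size d < n)%N.
  by rewrite szd -[ltnRHS](subnKC (ltnW (ltn_ord j))) ltn_add2r.
have /negP[] := minn _ ltd; apply/mem_expset; exists d.
  split=> // x; rewrite mem_cat => /orP[/mem_take|/mem_drop]; exact: cS.
rewrite -[in LHS](cat_take_drop j c) !big_cat /=; congr (_ * _)%g.
exact: esym eqp.
Qed.

Lemma coxlenP w : w \in <<S>>%g ->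
  w \in (S ^+ coxlen w)%g /\ forall n, w \in (S ^+ n)%g -> (coxlen w <= n)%N.
Proof.
move/gen_expset=> exw; have [n Sn minn] := ex_minnP exw.
have lenW : (n <= #|W|)%N.
  apply: (expset_short Sn) => m; rewrite ltnNge; exact: contra (minn m).
suff -> : coxlen w = n by [].
rewrite /coxlen -(subnKC (leqW lenW)) iotaD find_cat subSn //=.
have /negPf-> : ~~ has (fun m => w \in (S ^+ m)%g) (iota 0 n).
  apply/hasPn=> m; rewrite mem_iota add0n => /andP[_ ltmn].
  by apply: contraL ltmn => /minn; rewrite -leqNgt.
by rewrite size_iota add0n Sn addn0.
Qed.

End Coxeter.

(* Here B stands for (the underlying subspace of) a unital subalgebra of A;
   its left ideals are then automatically subspaces. *)
Section LoewyLength.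
Variables (K : fieldType) (A : falgType K) (B : {vspace A}).

Definition left_ideal (J : {vspace A}) : Prop := (J <= B)%VS /\ (B * J <= J)%VS.

Definition maximal_left_ideal (M : {vspace A}) : Prop :=
  [/\ left_ideal M, M <> B
    & forall J, left_ideal J -> (M <= J)%VS -> J = M \/ J = B].

(* The Jacobson radical. *)
Definition radical (x : A) : Prop :=
  x \in B /\ forall M, maximal_left_ideal M -> x \in M.

(* The k-th power of an ideal is spanned by the products of k of its elements,
   so it vanishes iff all of these products do. *)
Definition radical_pow_eq0 (k : nat) : Prop :=
  forall x : 'I_k -> A, (forall i, radical (x i)) -> \prod_(i < k) x i = 0.

Definition loewy_length (k : nat) : Prop :=
  [/\ (0 < k)%N, radical_pow_eq0 k
    & forall j, (0 < j)%N -> radical_pow_eq0 j -> (k <= j)%N].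

Lemma loewy_length_uniq k l : loewy_length k -> loewy_length l -> k = l.
Proof.
move=> [k0 zk mink] [l0 zl minl]; apply/eqP.
by rewrite eqn_leq mink // minl.
Qed.

End LoewyLength.

(* Main.v *)
Require Import Defs.
From mathcomp Require Import all_boot all_order all_algebra all_fingroup all_field.
From Stdlib Require Import Classical.

Set Implicit Arguments.
Unset Strict Implicit.
Unset Printing Implicit Defensive.

Import GRing.Theory Num.Theory.
Local Open Scope ring_scope.

(** The descent algebra acts on itself by triangular operators, and the number
    of layers on which they act bounds the Loewy length.

    Solomon's product formula shows that [x_I x_J] is a sum of elements [x_K]
    with [K] contained in [J] ([xelt_mul]).  Left multiplication by the descent
    algebra therefore preserves the span [G k] of the [x_K] with [#|K| < k], and
    is triangular on it for inclusion.  Elements of the radical are nilpotent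
    ([radical_nilpotent]), so their diagonal entries vanish and they map [G k.+1]
    to [G k] ([nilpotent_rank_filtration]).  Since [1 = x_S] lies in
    [G #|S|.+1], a product of [#|S|] radical elements lies in [G 1], the line of
    [x_set0].  Its last factor kills [x_set0], whereas [x_set0] is not nilpotent,
    so the product is zero: this is (a).

    For (b), the elements fixed by [sigma_0] are those that commute with [w_0].
    By inclusion-exclusion [w_0 x_J] is the alternating sum of the [x_K] with [K]
    contained in [J] ([longest_mul_xelt]), so [w_0] acts on [G k.+1 / G k] as the
    sign [(-1)^k].  An operator that commutes with [w_0] cannot connect two
    consecutive layers, on which the signs differ; hence a radical element of the
    fixed subalgebra drops the filtration by two
    ([commute_longest_rank_filtration]) and half as many factors suffice.

    The product formula is obtained geometrically.  The presentation of [W]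
    yields a cocycle [eta] that records which walls separate [1] from a chamber
    ([exists_cocycle]).  The pairs [(u, v)] in [X_I * X_J] with [u v = w]
    correspond to those cosets of [<<I>>] whose element nearest to [w^-1] has
    no descent in [J], and whether this happens depends on [w] only through its
    descents at the [s] in [J] that stabilise the coset ([minrep_gate]). *)

(** * The Jacobson radical of a finite-dimensional algebra *)

Section Radical.
Variables (K : fieldType) (A : falgType K) (B : {vspace A}).
Hypotheses (B1 : 1 \in B) (BM : (B * B <= B)%VS).

Lemma left_ideal_mull (J : {vspace A}) y x :
  left_ideal B J -> y \in B -> x \in J -> y * x \in J.
Proof. by case=> _ /subvP sJ yB xJ; rewrite sJ ?memv_mul. Qed.

Lemma principal_left_ideal y : y \in B -> left_ideal B (B * <[y]>)%VS.
Proof.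
move=> yB; split; last by rewrite prodvA prodvSl.
by apply: subv_trans BM; rewrite prodvSr // -memvE.
Qed.

Lemma mem_principal y : y \in (B * <[y]>)%VS.
Proof. by rewrite -{1}[y]mul1r memv_mul ?memv_line. Qed.

(** Dimension bounds ascending chains of left ideals, so Zorn's lemma reduces
    to an induction on the codimension. *)
Lemma exists_maximal_left_ideal (J : {vspace A}) :
  left_ideal B J -> J <> B ->
  exists2 M, maximal_left_ideal B M & (J <= M)%VS.
Proof.
have [n] := ubnP (\dim B - \dim J)%N.
elim: n J => // n IHn J; rewrite ltnS => leJn idJ nJB.
have [maxJ | nmaxJ] := classic (maximal_left_ideal B J); first by exists J.
have [J' [idJ' [sJJ' [nJ'J nJ'B]]]] :
    exists J', left_ideal B J' /\ (J <= J')%VS /\ J' <> J /\ J' <> B.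
  apply: NNPP => nex; apply: nmaxJ; split=> // J' idJ' sJJ'.
  have [|nJ] := classic (J' = J); first by left.
  have [|nB] := classic (J' = B); first by right.
  by case: nex; exists J'.
have ltJJ' : (\dim J < \dim J')%N.
  rewrite ltn_neqAle dimvS // andbT; apply/eqP=> eqd; apply: nJ'J.
  by apply/esym/eqP; rewrite eqEdim sJJ' eqd leqnn.
have leJ'B : (\dim J' <= \dim B)%N by apply: dimvS; case: idJ'.
have [|||M maxM sJ'M] := IHn J'; rewrite // ?(leq_trans _ leJn) //.
  by rewrite ltn_sub2l // (leq_trans ltJJ').
by exists M => //; apply: subv_trans sJ'M.
Qed.

Lemma radical_mull y x : y \in B -> radical B x -> radical B (y * x).
Proof.
move=> yB [xB radx]; split; first by rewrite (subvP BM) ?memv_mul.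
move=> M maxM; case: (maxM) => idM _ _.
exact: left_ideal_mull idM yB (radx M maxM).
Qed.

(** [1 - x] lies in no maximal left ideal, since each of them contains [x]. *)
Lemma radical_quasiregular x :
  radical B x -> exists2 u, u \in B & u * (1 - x) = 1.
Proof.
move=> [xB radx].
have x1B : 1 - x \in B by rewrite memvB.
suff : (B * <[1 - x]>)%VS = B.
  rewrite -limg_amulr => eqB; move: B1; rewrite -{1}eqB.
  by case/memv_imgP=> u uB; rewrite lfunE /= => eq1; exists u.
apply: NNPP => nB.
have [M maxM sM] := exists_maximal_left_ideal (principal_left_ideal x1B) nB.
case: (maxM) => idM nMB _; apply: nMB; apply/eqP; rewrite eqEsubv.
have M1 : 1 \in M.
  by rewrite -(subrK x 1) memvD ?radx // (subvP sM) ?mem_principal.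
case: (idM) => -> _ /=; apply/subvP=> b bB.
by rewrite -[b]mulr1 (left_ideal_mull idM).
Qed.

(** The descending chain of the left ideals [B x^n] becomes stationary, which
    gives [x^n = y x^{n+1}] for some [y], hence [(1 - y x) x^n = 0] with
    [1 - y x] left invertible. *)
Lemma radical_nilpotent x : radical B x -> exists n, x ^+ n = 0.
Proof.
move=> radx; case: (radx) => xB _.
have xnB n : x ^+ n \in B.
  by elim: n => [|n IHn]; rewrite // exprS (subvP BM) ?memv_mul.
pose V n := (B * <[x ^+ n]>)%VS.
have sV n : (V n.+1 <= V n)%VS.
  apply/prodvP=> b _ bB /vlineP[k ->].
  by rewrite exprS -scalerAr mulrA memvZ // memv_mul ?memv_line //
             (subvP BM) // memv_mul.
have [n eqV] : exists n, V n.+1 = V n.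
  apply: NNPP => nex.
  have ltd m : (\dim (V m) + m <= \dim (V 0%N))%N.
    elim: m => [|m IHm]; rewrite ?addn0 // addnS; apply: leq_trans IHm.
    rewrite -addSn leq_add2r ltn_neqAle dimvS // andbT; apply/eqP=> eqd.
    by case: nex; exists m; apply/eqP; rewrite eqEdim sV eqd /=.
  have := ltd (\dim (V 0%N)).+1.
  by rewrite leqNgt addnS ltnS leq_addl.
have : x ^+ n \in V n.+1 by rewrite eqV mem_principal.
rewrite /V -limg_amulr => /memv_imgP[y yB]; rewrite lfunE /= => eqx.
have [u _ u1] := radical_quasiregular (radical_mull yB radx).
exists n; rewrite -[LHS]mul1r -u1 -mulrA mulrBl mul1r -mulrA -exprS -eqx.
by rewrite subrr mulr0.
Qed.

Lemma loewy_length_le k :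
  (0 < k)%N -> radical_pow_eq0 B k ->
  exists LL, loewy_length B LL /\ (LL <= k)%N.
Proof.
move=> k0 zk; apply: NNPP => nex.
suff nz n : forall j, (0 < j)%N -> (j <= n)%N -> ~ radical_pow_eq0 B j.
  exact: (nz k k).
elim: n => [|n IHn] j j0 lejn zj; first by rewrite leqNgt j0 in lejn.
have [lejk|ltkj] := leqP j k; last first.
  by apply: (IHn k) => //; rewrite -ltnS (leq_trans ltkj).
case: nex; exists j; split=> //; split=> // i i0 zi.
rewrite leqNgt; apply/negP=> ltij.
by apply: (IHn i); rewrite // -ltnS (leq_trans ltij).
Qed.

End Radical.

(** * The reflection cocycle of a Coxeter system *)

Section Cocycle.
Local Open Scope group_scope.
Variable W : finGroupType.
Implicit Types (s t u v w : W) (p : W * bool).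

Definition flip s p : W * bool := (p.1 ^ s, p.2 (+) (p.1 == s)).

Lemma flip_inj s : injective (flip s).
Proof.
by move=> [t e] [t' e'] [/conjg_inj-> /addIb->].
Qed.

Definition flip_perm s : {perm W * bool} := perm (flip_inj (s := s)).

(** Each of the first [2 n] reflections [r^j s], where [r = s t], met along the
    alternating word [(s t)^n] flips the sign once. *)
Lemma flip_perm_expg s t n x e :
  s ^+ 2 = 1 -> t ^+ 2 = 1 ->
  ((flip_perm s * flip_perm t) ^+ n) (x, e) =
  (x ^ ((s * t) ^+ n),
   e (+) odd (\sum_(0 <= j < n.*2) (x == (s * t) ^+ j * s)%g)%N).
Proof.
move=> s2 t2.
have sV : s^-1 = s by apply/eqP; rewrite eq_invg_mul -expg2 s2.
have tV : t^-1 = t by apply/eqP; rewrite eq_invg_mul -expg2 t2.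
set r := s * t; have sr : s * r = r^-1 * s.
  by rewrite invMg sV tV /r mulgA -expg2 s2 mul1g -mulgA -expg2 s2 mulg1.
have srj j : s * r ^+ j = r ^- j * s.
  elim: j => [|j IHj]; first by rewrite !expg0 invg1 mulg1 mul1g.
  by rewrite [in RHS]expgS invMg expgSr mulgA IHj -mulgA sr mulgA.
have srV j : s * r ^- j = r ^+ j * s.
  by apply: (mulIg (r ^+ j)); rewrite mulgKV -mulgA srj mulKVg.
elim: n => [|n IHn]; first by rewrite perm1 conjg1 big_nil addbF.
rewrite expgSr !permM IHn !permE /flip /= -!conjgM -expgSr.
congr pair; rewrite doubleS !big_nat_recr //= !oddD !oddb -!addbA.
congr (_ (+) (_ (+) (_ (+) _))).
  rewrite -(inj_eq (@conjg_inj _ (r ^- n))) conjgK conjgE invgK srV.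
  by rewrite mulgA -expgD addnn.
rewrite -(inj_eq (@conjg_inj _ (r ^+ n * s)^-1)) conjgK conjgE invgK invMg sV.
by rewrite srV !mulgA -[_ * s * t]mulgA -/r -expgSr -expgD addSn addnn.
Qed.

(** Since [(s t)^m = 1], each reflection is met twice along [(s t)^m]. *)
Lemma flip_perm_order s t :
  s ^+ 2 = 1 -> t ^+ 2 = 1 ->
  (flip_perm s * flip_perm t) ^+ #[s * t] = 1.
Proof.
move=> s2 t2; apply/permP=> -[x e].
rewrite flip_perm_expg // perm1 expg_order conjg1 -addnn.
rewrite (big_cat_nat (n := #[s * t])) ?leq_addr //=.
rewrite -[X in (_ + \sum_(X <= _ < _) _)%N]add0n big_addn addnK.
under [X in (_ + X)%N]eq_bigr => i _ do rewrite expgD expg_order mulg1.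
by rewrite addnn odd_double addbF.
Qed.

(** [eta] is the sign component of the action of [W] on [W * bool] in which a
    generator [s] acts as [flip s]; the universal property of [W] provides this
    action.  For a reflection [t], [eta t w] says whether the wall of [t]
    separates the chambers [1] and [w]. *)
Lemma exists_cocycle (S : {set W}) : coxeter_system S ->
  exists eta : W -> W -> bool,
    (forall t u v, eta t (u * v) = eta t u (+) eta (t ^ u) v) /\
    (forall s t, s \in S -> eta t s = (t == s)).
Proof.
case=> genS ordS univ.
have sq s : s \in S -> s ^+ 2 = 1 by move=> sS; rewrite -(ordS s sS) expg_order.
have [|phi phiM phiS] := univ {perm W * bool} flip_perm.
  by move=> s t sS tS; apply: flip_perm_order; apply: sq.
have phi1 : phi 1 = 1 by apply: (mulgI (phi 1)); rewrite -phiM !mulg1.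
have phiE w x e : phi w (x, e) = (x ^ w, e (+) (phi w (x, false)).2).
  have: w \in <<S>> by rewrite genS.
  case/gen_prodgP=> n [c cS ->]; elim: n c cS x e => [|n IHn] c cS x e.
    by rewrite big_ord0 phi1 !perm1 conjg1 addbF.
  rewrite big_ord_recl phiM (phiS _ (cS ord0)) !permM !permE /flip /=.
  by rewrite IHn // [in RHS]IHn //= conjgM addbA.
exists (fun t w => (phi w (t, false)).2); split=> [t u v | s t sS].
  by rewrite phiM permM (phiE u) phiE.
by rewrite phiS // permE.
Qed.

End Cocycle.

(** * Lengths, descents and cosets of parabolic subgroups *)

Section CoxeterLength.
Local Open Scope group_scope.
Variables (W : finGroupType) (S : {set W}) (eta : W -> W -> bool).
Hypothesis coxS : coxeter_system S.
Hypothesis etaM : forall t u v, eta t (u * v) = eta t u (+) eta (t ^ u) v.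
Hypothesis etaS : forall s t, s \in S -> eta t s = (t == s).
Implicit Types (I J : {set W}) (s t u v w : W) (c : seq W).

Lemma cocycle1 t : eta t 1 = false.
Proof. by have := etaM t 1 1; rewrite mulg1 conjg1 addbb. Qed.

Lemma cocycleV t u : eta t u^-1 = eta (t ^ u^-1) u.
Proof.
have := etaM t u^-1 u; rewrite mulVg cocycle1 => /esym/negbT.
by rewrite negb_add => /eqP.
Qed.

Lemma in_gen w : w \in <<S>>.
Proof. by case: coxS => -> _ _; rewrite inE. Qed.

Lemma mulSS s : s \in S -> s * s = 1.
Proof. by case: coxS => _ ordS _ sS; rewrite -expg2 -(ordS s sS) expg_order. Qed.

Definition reflection t := exists s g, s \in S /\ t = s ^ g.

Lemma reflectionS s : s \in S -> reflection s.
Proof. by move=> sS; exists s, 1; rewrite conjg1. Qed.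

Lemma reflectionJ t g : reflection t -> reflection (t ^ g).
Proof. by case=> s [h [sS ->]]; exists s, (h * g); rewrite conjgM. Qed.

Lemma reflection_mulgg t : reflection t -> t * t = 1.
Proof. by case=> s [g [sS ->]]; rewrite -conjMg mulSS // conj1g. Qed.

Lemma cocycle_reflection t : reflection t -> eta t t.
Proof.
case=> s [g [sS ->]]; have sgK : (s ^ g) ^ g^-1 = s by rewrite conjgK.
rewrite {2}conjgE mulgA !etaM cocycleV conjgM !sgK conjgE mulKg.
by rewrite (etaS _ sS) eqxx addbC addbA addbb.
Qed.

(** The strong exchange condition, for words in the generators of a parabolic
    subgroup: by the cocycle rule [eta t] can only hold on a product if [t] is
    the conjugate of some letter by the letters before it, and multiplying by
    this [t] deletes the letter. *)
Lemma exchange I t c :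
  I \subset S -> {subset c <= I} -> eta t (\prod_(x <- c) x) ->
  exists c', [/\ (size c').+1 = size c, {subset c' <= I}
               & t * \prod_(x <- c) x = \prod_(x <- c') x].
Proof.
move=> sIS; elim: c t => [|s c IHc] t cI; first by rewrite big_nil cocycle1.
have sI : s \in I by rewrite cI ?mem_head.
have cI' : {subset c <= I} by move=> x xc; rewrite cI // inE xc orbT.
rewrite big_cons etaM etaS ?(subsetP sIS) //; have [-> _|_ /=] := eqVneq t s.
  by exists c; rewrite mulgA mulSS ?mul1g ?(subsetP sIS).
case/IHc=> // c' [szc' c'I eqc']; exists (s :: c'); split=> /=.
- by rewrite szc'.
- by move=> x; rewrite inE => /predU1P[->//|/c'I].
by rewrite big_cons -eqc' conjgE !mulgA mulgV mul1g.
Qed.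

Lemma coxlen_reduced I w : w \in <<I>> ->
  exists c, [/\ size c = coxlen I w, {subset c <= I}
              & w = \prod_(x <- c) x].
Proof.
by case/coxlenP => /mem_expset[c [szc cI] eqw] _; exists c.
Qed.

Lemma coxlen_word I c : {subset c <= I} ->
  (coxlen I (\prod_(x <- c) x) <= size c)%N.
Proof.
move=> cI; have cIn : \prod_(x <- c) x \in I ^+ size c.
  by apply/mem_expset; exists c.
have cgI : \prod_(x <- c) x \in <<I>>.
  by rewrite big_seq; apply: group_prod => x /cI; apply: mem_gen.
by case: (coxlenP cgI) => _; apply.
Qed.

Lemma cocycle_coxlen t w : eta t w -> (coxlen S (t * w) < coxlen S w)%N.
Proof.
case: (coxlen_reduced (in_gen w)) => c [<- cS ->].
case/(exchange (subxx S) cS) => c' [<- c'S ->].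
by rewrite ltnS coxlen_word.
Qed.

Lemma coxlen_cocycleN t w :
  reflection t -> (coxlen S w < coxlen S (t * w))%N = ~~ eta t w.
Proof.
move=> tR; case etw: (eta t w).
  by apply/negbTE; rewrite -leqNgt ltnW // cocycle_coxlen.
have: eta t (t * w) by rewrite etaM cocycle_reflection // conjgE mulKg etw.
by move/cocycle_coxlen; rewrite mulgA reflection_mulgg // mul1g.
Qed.

Lemma minrepP I w : I \subset S ->
  reflect (forall s, s \in I -> eta s w^-1 = false) (w \in minrep S I).
Proof.
move=> sIS; rewrite inE.
have eqs s : s \in I ->
  (coxlen S w < coxlen S (w * s))%N = ~~ eta s w^-1.
  move=> sI; have sS := reflectionS (subsetP sIS _ sI).
  have -> : w * s = s ^ w^-1 * w by rewrite conjgE invgK !mulgA mulgKV.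
  by rewrite coxlen_cocycleN -?cocycleV //; apply: reflectionJ.
apply: (iffP forall_inP) => H s sI; last by rewrite eqs // H.
by have := H s sI; rewrite eqs // => /negbTE.
Qed.

(** Every wall between [1] and [v] belongs to the parabolic subgroup of [v],
    because exchange writes [t v] as a word in the same letters. *)
Lemma cocycle_gen I t v : I \subset S -> v \in <<I>> -> eta t v -> t \in <<I>>.
Proof.
move=> sIS vI; case: (coxlen_reduced vI) => c [_ cI eqv].
rewrite eqv => /(exchange sIS cI)[c' [_ c'I]].
rewrite -eqv => /(canRL (mulgK v)) ->; rewrite groupM ?groupV //.
by rewrite big_seq; apply: group_prod => x /c'I; apply: mem_gen.
Qed.

(** The first letter of a shortest word in [I] is a left descent: otherwise
    exchange would shorten the word. *)
Lemma cocycle_descent I v : I \subset S -> v \in <<I>> -> v != 1 ->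
  exists2 s, s \in I & eta s v.
Proof.
move=> sIS vI v1; case: (coxlen_reduced vI) => -[|s c] [szc cI eqv].
  by rewrite eqv big_nil eqxx in v1.
have sI : s \in I by rewrite cI ?mem_head.
exists s => //; rewrite eqv big_cons etaM etaS ?(subsetP sIS) // eqxx.
rewrite conjgE mulKg.
have cI' : {subset c <= I} by move=> x xc; rewrite cI // inE xc orbT.
apply/negP => /(exchange sIS cI')[c' [szc' c'I eqc']]; have := coxlen_word c'I.
have eqsv : s * \prod_(x <- c) x = v by rewrite eqv big_cons.
by rewrite -eqc' eqsv -szc /= -szc' ltnNge leqnSn.
Qed.

(** The point of the coset [C = g <<I>>] nearest to [w^-1] is its gate: for [w e]
    a shortest element of [w C], no wall of that coset separates [w e] from [1],
    and [w e] is the only element of [w C] without descents in [I], since any two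
    elements of [w C] are separated by a wall of it. *)
Lemma coset_gate I w g : I \subset S ->
  exists e, [/\ e \in g *: <<I>>,
    forall t, t \in <<I>> -> eta t (w * e)^-1 = false
    & forall e', e' \in g *: <<I>> -> w * e' \in minrep S I -> e' = e].
Proof.
move=> sIS; have gg := lcoset_refl [group of <<I>>] g.
case: (arg_minnP (fun x => coxlen S (w * x)) gg) => e /= eg mine.
have pos t : t \in <<I>> -> eta t (w * e)^-1 = false.
  move=> tI; set u := w * e.
  rewrite cocycleV; apply/negP => /cocycle_coxlen.
  have -> : t ^ u^-1 * u = w * (e * t).
    by rewrite conjgE invgK -!mulgA mulVg mulg1 /u !mulgA.
  rewrite ltnNge mine //; change (e * t \in g *: <<I>>).
  case/lcosetP: eg => a aI ->.
  by rewrite -mulgA mem_lcoset mulKg groupM.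
exists e; split=> // e' e'g we'; apply/eqP; rewrite -(inj_eq (mulgI e^-1)) mulVg.
have vI : e^-1 * e' \in <<I>>.
  by rewrite -mem_lcoset (lcoset_eqP eg).
apply: contraTT we' => v1; apply/negP => /(minrepP _ sIS) pos'.
have vVI : (e^-1 * e')^-1 \in <<I>> by rewrite groupV.
have [|s sI] := cocycle_descent sIS vVI; first by rewrite eq_invg1.
have sV : s ^ (e^-1 * e')^-1 \in <<I>> by apply: groupJ; rewrite // mem_gen.
have := pos' s sI.
have -> : w * e' = w * e * (e^-1 * e') by rewrite -mulgA mulKVg.
by rewrite invMg etaM (pos _ sV) addbF => ->.
Qed.

(** If [C] is a face of the Coxeter complex, these are the walls, among those of
    the fundamental chamber indexed by [J], that contain the face. *)
Definition coset_stab J (C : {set W}) := [set s in J | s *: C == C].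

(** The walls indexed by [J] that do not contain the face [C] have it on the same
    side as the fundamental chamber. *)
Definition coset_pos J (C : {set W}) :=
  [forall s in J, (s *: C != C) ==> [forall e in C, ~~ eta s e]].

Lemma lcoset_fix I s e :
  (s *: (e *: <<I>>) == e *: <<I>>) = (s ^ e \in <<I>>).
Proof.
have -> : s *: (e *: <<I>>) = (s * e) *: <<I>> by rewrite lcosetM.
by rewrite -(sameP lcoset_eqP eqP) mem_lcoset conjgE.
Qed.

(** Here [e] is the gate of its coset [C] for [w^-1].  A wall that contains [C]
    does not separate the gate from [w^-1], so it separates [1] from [e] exactly
    when it separates [1] from [w^-1]; any other wall has all of [C] on one
    side. *)
Lemma minrep_gate I J w e : I \subset S -> J \subset S ->
  (forall t, t \in <<I>> -> eta t (w * e)^-1 = false) ->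
  (e^-1 \in minrep S J) =
  coset_pos J (e *: <<I>>) && (w \in minrep S (coset_stab J (e *: <<I>>))).
Proof.
move=> sIS sJS pos; have ee := lcoset_refl [group of <<I>>] e.
have sKS : coset_stab J (e *: <<I>>) \subset S.
  by apply: subset_trans sJS; apply/subsetP=> s; rewrite inE => /andP[].
have in_stab s : s ^ e \in <<I>> -> eta s e = eta s w^-1.
  move=> /pos; rewrite invMg etaM (cocycleV _ e) conjgK => /negbT.
  by rewrite negb_add => /eqP.
have out_stab s e' : s ^ e \notin <<I>> -> e' \in e *: <<I>> ->
    eta s e' = eta s e.
  move=> sN /lcosetP[v vI ->]; rewrite etaM.
  case ev: (eta (s ^ e) v); last by rewrite addbF.
  by rewrite (cocycle_gen sIS vI ev) in sN.
apply/minrepP/andP=> // [posJ | [/forall_inP posC /minrepP posK] s sJ].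
  split; last apply/minrepP=> // s.
    apply/forall_inP=> s sJ; apply/implyP; rewrite lcoset_fix => sN.
    by apply/forall_inP=> e' /(out_stab _ _ sN) ->; rewrite -[e]invgK posJ.
  by rewrite inE lcoset_fix => /andP[sJ /in_stab <-]; rewrite -[e]invgK posJ.
rewrite invgK; have := posC s sJ; rewrite lcoset_fix.
have [sI _|sN /forall_inP/(_ e ee)/negbTE //] := boolP (s ^ e \in <<I>>).
by rewrite in_stab // posK // inE sJ lcoset_fix.
Qed.

End CoxeterLength.

(** * Solomon's product formula *)

Lemma prodr_forall (T : finType) (K : {set T}) (p : pred T) :
  \prod_(s in K) (p s)%:R = [forall s in K, p s]%:R :> rat.
Proof.
have [/forall_inP pK|] := boolP [forall s in K, p s].
  by rewrite big1 // => s /pK ->.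
rewrite negb_forall_in => /exists_inP[s sK /negPf ps].
by rewrite (bigD1 s) //= ps mul0r.
Qed.

(** Expand the product of the [1 - p s] for [s] in [J]. *)
Lemma inclusion_exclusion (T : finType) (J : {set T}) (p : pred T) :
  [forall s in J, ~~ p s]%:R =
  \sum_(K : {set T} | K \subset J) (-1) ^+ #|K| * [forall s in K, p s]%:R :> rat.
Proof.
rewrite -prodr_forall big_mkcond /=.
under eq_bigr => s _.
  rewrite (_ : (if _ then _ else _) = (if s \in J then - (p s)%:R else 0) + 1).
    over.
  by case: (s \in J); case: (p s); rewrite ?addNr ?oppr0 ?add0r.
rewrite bigA_distr (bigID (fun K : {set T} => K \subset J)) /=.
rewrite [X in _ + X]big1 ?addr0 => [|K /subsetPn[s sK sJ]]; last first.
  by rewrite (bigD1 s) //= sK (negPf sJ) mul0r.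
apply: eq_bigr => K sKJ; rewrite -prodr_forall -prodrN -big_mkcond.
by apply: eq_bigr => s sK; rewrite (subsetP sKJ).
Qed.

Section Solomon.
Variables (W : finGroupType) (S : {set W}) (eta : W -> W -> bool).
Hypothesis coxS : coxeter_system S.
Hypothesis etaM :
  forall t u v, eta t (u * v)%g = eta t u (+) eta (t ^ u)%g v.
Hypothesis etaS : forall s t, s \in S -> eta t s = (t == s).
Implicit Types (I J K : {set W}) (a b : galg W).

Lemma galg_mulE a b w : (a * b) w = \sum_u a u * b (u^-1 * w)%g.
Proof. by rewrite [a * b]/(gmul a b) ffunE. Qed.

Lemma xeltE I w : xelt S I w = (w \in minrep S I)%:R.
Proof.
rewrite sum_ffunE; have [wI|wI] := boolP (w \in _).
  rewrite (bigD1 w) //= big1 => [|u /andP[_ nu]].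
    by rewrite ffunE eqxx addr0.
  by rewrite ffunE eq_sym (negPf nu).
rewrite big1 // => u uI; rewrite ffunE; case: eqP => // equ.
by rewrite equ uI in wI.
Qed.

(** The coefficient of [w] in [x_I x_J] counts the [e] with [w e] in [X_I] and
    [e^-1] in [X_J].  In each coset of [<<I>>] only the gate [e] satisfies the
    first condition, and by [minrep_gate] the second one then says that the
    coset contributes the coefficient of [w] in a single [x_K]. *)
Lemma xelt_mul I J : I \subset S -> J \subset S ->
  xelt S I * xelt S J =
  \sum_(C in lcosets <<I>>%g [set: W] | coset_pos eta J C)
    xelt S (coset_stab J C).
Proof.
move=> sIS sJS; apply/ffunP=> w; rewrite galg_mulE sum_ffunE.
rewrite (reindex_inj (mulgI w)) /=.
under eq_bigr => e _ do rewrite !xeltE invMg mulgKV.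
rewrite (partition_big (fun e => e *: <<I>>)%g
           (mem (lcosets <<I>>%g [set: W]))) /=; last first.
  by move=> e _; apply/lcosetsP; exists e.
rewrite [RHS]big_mkcondr /=; apply: eq_bigr => C /lcosetsP[g _ ->{C}].
have [e [eg pos uniq_e]] := coset_gate coxS etaM etaS w g sIS.
have eqC : (e *: <<I>> = g *: <<I>>)%g by apply/lcoset_eqP.
rewrite (bigD1 e) /= ?eqC // big1 => [|e' /andP[/eqP eqe' ne']]; last first.
  case we': (w * e' \in _)%g; last by rewrite mul0r.
  case/eqP: ne'; apply: uniq_e => //; rewrite -eqe'.
  exact: (lcoset_refl [group of <<I>>%g]).
have -> : (w * e \in minrep S I)%g.
  apply/(minrepP coxS etaM etaS _ sIS) => s sI.
  by rewrite pos // mem_gen.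
rewrite mul1r addr0 (minrep_gate coxS etaM etaS sIS sJS pos) eqC xeltE.
by case: coset_pos.
Qed.

(** All the left ideals and layers of the argument are of this form. *)
Definition xspan (P : pred {set W}) : {vspace galg W} :=
  (\sum_(K : {set W} | (K \subset S) && P K) <[xelt S K]>)%VS.

Lemma xspan_sub (P : pred {set W}) (V : {vspace galg W}) :
  (forall K, K \subset S -> P K -> xelt S K \in V) -> (xspan P <= V)%VS.
Proof.
by move=> PV; apply/subv_sumP=> K /andP[sKS PK]; rewrite -memvE PV.
Qed.

Lemma mem_xspan (P : pred {set W}) K :
  K \subset S -> P K -> xelt S K \in xspan P.
Proof.
by move=> sKS PK; rewrite memvE (sumv_sup K) ?sKS.
Qed.

Lemma xspanS (P Q : pred {set W}) : (forall K, K \subset S -> P K -> Q K) ->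
  (xspan P <= xspan Q)%VS.
Proof. by move=> sPQ; apply: xspan_sub => K sKS PK; apply: mem_xspan; auto. Qed.

Lemma descent_algebraE : descent_algebra S = xspan predT.
Proof.
apply/eqP; rewrite eqEsubv; apply/andP; split.
  apply/span_subvP=> x /mapP[K]; rewrite mem_enum powersetE => sKS ->.
  exact: mem_xspan.
apply: xspan_sub => K sKS _; apply/memv_span/map_f.
by rewrite mem_enum powersetE.
Qed.

(** The product formula only produces subsets of the index on the right. *)
Lemma xspan_mull (P : pred {set W}) a x :
  (forall K J, K \subset J -> P J -> P K) ->
  a \in descent_algebra S -> x \in xspan P -> a * x \in xspan P.
Proof.
move=> Pdown aS; suff sP : (xspan P <= amull a @^-1: xspan P)%VS.
  by move/(subvP sP); rewrite -memv_preim lfunE.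
apply: xspan_sub => J sJS PJ; rewrite -memv_preim lfunE /=.
suff sP : (xspan predT <= amulr (xelt S J) @^-1: xspan P)%VS.
  move: aS; rewrite descent_algebraE => /(subvP sP).
  by rewrite -memv_preim lfunE.
apply: xspan_sub => I sIS _; rewrite -memv_preim lfunE /= xelt_mul //.
apply: memv_suml => C _.
have sCJ : coset_stab J C \subset J.
  by apply/subsetP=> s; rewrite inE => /andP[].
by apply: mem_xspan (Pdown _ _ sCJ PJ); apply: subset_trans sJS.
Qed.

Lemma descent_algebraM a b :
  a \in descent_algebra S -> b \in descent_algebra S ->
  a * b \in descent_algebra S.
Proof. by rewrite {2 3}descent_algebraE; apply: xspan_mull. Qed.

Lemma minrep_set0 w : w \in minrep S set0.
Proof. by rewrite inE; apply/forall_inP=> s; rewrite inE. Qed.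

Lemma xeltS : xelt S S = 1.
Proof.
apply/ffunP=> w; rewrite xeltE -gelt1 ffunE; congr (_%:R); congr nat_of_bool.
apply/(minrepP coxS etaM etaS _ (subxx S))/eqP => [wS|-> s sS]; last first.
  by rewrite invg1 (cocycle1 etaM).
apply/eqP; rewrite -eq_invg1; apply: contraT => w1.
have [s sS] := cocycle_descent coxS etaM etaS (subxx S) (in_gen coxS w^-1%g) w1.
by rewrite wS.
Qed.

Lemma descent_algebra1 : 1 \in descent_algebra S.
Proof. by rewrite descent_algebraE -xeltS mem_xspan. Qed.

(** Multiplication by [a] is triangular on the [x_K]; the diagonal coefficient of
    a nilpotent element vanishes. *)
Lemma nilpotent_mul_xelt a J n :
  a \in descent_algebra S -> a ^+ n = 0 -> J \subset S ->
  a * xelt S J \in xspan (fun K => K \proper J).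
Proof.
move=> aS an0 sJS; set U := xspan _.
have aU x : x \in U -> a * x \in U.
  apply: xspan_mull => // K L sKL; exact: sub_proper_trans.
have [c eqc] : exists c, a * xelt S J - c *: xelt S J \in U.
  have : a * xelt S J \in xspan (fun K => K \subset J).
    apply: xspan_mull => // [K L|]; first exact: subset_trans.
    exact: mem_xspan.
  have sJU : (xspan (fun K => K \subset J) <= <[xelt S J]> + U)%VS.
    apply: xspan_sub => K sKS; rewrite subEproper => /predU1P[->|ltKJ].
      by rewrite (subvP (addvSl _ _)) ?memv_line.
    by rewrite (subvP (addvSr _ _)) // mem_xspan.
  case/(subvP sJU)/memv_addP=> _ /vlineP[c ->] [u uU ->].
  by exists c; rewrite addrC addKr.
have pow m : a ^+ m * xelt S J - c ^+ m *: xelt S J \in U.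
  elim: m => [|m IHm]; first by rewrite mul1r scale1r subrr mem0v.
  have := memvD (aU _ IHm) (memvZ (c ^+ m) eqc).
  rewrite mulrBr mulrA -exprS scalerBr scalerA -exprSr -scalerAr.
  by rewrite addrA subrK.
(* If [c] were nonzero, [x_J] itself would lie in [U], which [a] preserves. *)
have [c0|c0] := eqVneq c 0; first by rewrite c0 scale0r subr0 in eqc.
have := pow n; rewrite an0 mul0r sub0r memvN => /(memvZ (c ^+ n)^-1).
by rewrite scalerA mulVf ?expf_neq0 // scale1r; apply: aU.
Qed.

(** The longest element exchanges ascents and descents, so that [w_0 x_J] is
    the indicator function of the [w] with all of [J] among their descents;
    inclusion-exclusion expands it in the [x_K]. *)
Lemma longest_mul_xelt J : J \subset S ->
  gelt (longest S) * xelt S J =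
  \sum_(K : {set W} | K \subset J) (-1) ^+ #|K| *: xelt S K.
Proof.
move=> sJS; apply/ffunP=> w; rewrite galg_mulE sum_ffunE; set w0 := longest S.
rewrite (bigD1 w0) //= big1 => [|u nu]; last by rewrite ffunE (negPf nu) mul0r.
rewrite ffunE eqxx mul1r addr0 xeltE.
(* Every wall separates [1] from [w_0], by maximality of its length. *)
have w0eta t : reflection S t -> eta t w0.
  move=> tR; apply: contraT.
  rewrite -(coxlen_cocycleN coxS etaM etaS) //.
  rewrite /w0 /longest; case: arg_maxnP => //= u _ maxu.
  by rewrite ltnNge => /negP[]; apply: maxu.
have -> : (w0^-1 * w \in minrep S J)%g = [forall s in J, eta s w^-1%g].
  apply/(minrepP coxS etaM etaS _ sJS)/forall_inP => H s sJ.
    have := H s sJ; rewrite invMg invgK etaM w0eta ?addbT => [/negbFE //|].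
    by apply/reflectionJ/reflectionS/(subsetP sJS).
  rewrite invMg invgK etaM w0eta ?H //.
  by apply/reflectionJ/reflectionS/(subsetP sJS).
have := inclusion_exclusion J (fun s => ~~ eta s w^-1%g).
under eq_forallb => s do rewrite negbK.
move=> ->; apply: eq_bigr => K sKJ; rewrite ffunE xeltE; congr (_ * _%:R).
congr nat_of_bool; apply/forall_inP/minrepP => //.
- exact: subset_trans sJS.
- by move=> H s sK; apply/negbTE/H.
by move=> H s /H ->.
Qed.

(** * The filtration by rank *)

Definition rank_filtration (k : nat) : {vspace galg W} :=
  xspan (fun K => #|K| < k)%N.
Local Notation G := rank_filtration.

Lemma rank_filtration0 x : x \in G 0 -> x = 0.
Proof.
move/(subvP (xspan_sub (V := 0%VS) _)); rewrite memv0 => H.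
by apply/eqP/H => K _; rewrite ltn0.
Qed.

Lemma rank_filtration1 x : x \in G 1 -> exists c, x = c *: xelt S set0.
Proof.
move=> xG; apply/vlineP; apply: subvP xG; apply: xspan_sub => K _.
by rewrite ltnS leqn0 cards_eq0 => /eqP->; apply: memv_line.
Qed.

Lemma mem1_rank_filtration k : (#|S| < k)%N -> 1 \in G k.
Proof. by move=> ltSk; rewrite -xeltS mem_xspan. Qed.

Lemma nilpotent_rank_filtration a n k x :
  a \in descent_algebra S -> a ^+ n = 0 -> x \in G k.+1 -> a * x \in G k.
Proof.
move=> aS an0 xG; suff sG : (G k.+1 <= amull a @^-1: G k)%VS.
  by move/(subvP sG): xG; rewrite -memv_preim lfunE.
apply: xspan_sub => J sJS ltJk; rewrite -memv_preim lfunE /=.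
apply: subvP (nilpotent_mul_xelt aS an0 sJS); apply: xspanS => K _ ltKJ.
by rewrite -ltnS (leq_trans _ ltJk) // ltnS proper_card.
Qed.

(** On each layer of the filtration [w_0] acts as a sign, given by the parity of
    the rank. *)
Lemma longest_rank_filtration k x : x \in G k.+1 ->
  gelt (longest S) * x - (-1) ^+ k *: x \in G k.
Proof.
move=> xG; pose f := (amull (gelt (longest S)) - (-1) ^+ k *: \1)%VF.
suff sG : (G k.+1 <= f @^-1: G k)%VS.
  by move/(subvP sG): xG; rewrite -memv_preim !lfun_simp /=.
apply: xspan_sub => J sJS ltJk; rewrite -memv_preim !lfun_simp /=.
rewrite longest_mul_xelt // (bigD1 J) //= addrAC -scalerBl rpredD //.
  move: ltJk; rewrite ltnS leq_eqVlt => /predU1P[->|ltJk].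
    by rewrite subrr scale0r mem0v.
  by rewrite memvZ // mem_xspan.
apply: memv_suml => K /andP[sKJ nKJ]; apply: memvZ; apply: mem_xspan.
  exact: subset_trans sJS.
by rewrite -ltnS (leq_trans _ ltJk) // ltnS proper_card // properEneq nKJ.
Qed.

(** If [a] commutes with [w_0], it cannot connect consecutive layers, where
    [w_0] acts by opposite signs.  Concretely, [w_0 (a x)] and [a (w_0 x)] agree,
    but modulo [G k] they are [(-1)^k (a x)] and [- (-1)^k (a x)]. *)
Lemma commute_longest_rank_filtration a n k x :
  a \in descent_algebra S -> a ^+ n = 0 ->
  a * gelt (longest S) = gelt (longest S) * a ->
  x \in G k.+2 -> a * x \in G k.
Proof.
move=> aS an0 aw xG; have nilG := nilpotent_rank_filtration aS an0.
have := nilG _ _ (longest_rank_filtration xG).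
have := longest_rank_filtration (nilG _ _ xG).
set e : rat := (-1) ^+ k; have e0 : e != 0 by rewrite expf_neq0 ?oppr_eq0.
rewrite exprS mulN1r -/e scaleNr opprK mulrDr -scalerAr !mulrA aw => G1 G2.
have := memvB G2 G1; rewrite opprD opprK addrACA subrr add0r -scalerDl.
move/(memvZ (e + e)^-1); rewrite scalerA mulVf ?scale1r //.
by rewrite -mulr2n mulrn_eq0.
Qed.

Lemma prod_rank_filtration d k (x : 'I_k -> galg W) m v :
  (forall i j u, u \in G (d + j)%N -> x i * u \in G j) ->
  v \in G (k * d + m)%N -> (\prod_(i < k) x i) * v \in G m.
Proof.
elim: k x m => [|k IHk] x m xG vG; first by rewrite big_ord0 mul1r.
rewrite big_ord_recl -mulrA xG // IHk // => [i j u|]; first exact: xG.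
by rewrite addnCA addnA.
Qed.

(** [x_set0] is the sum of all of [W], whose square is [#|W|] times itself. *)
Lemma xelt0_mul_eq0 c : (c *: xelt S set0) * xelt S set0 = 0 -> c = 0.
Proof.
move/ffunP/(_ 1%g)/eqP; rewrite -scalerAl ffunE galg_mulE.
under eq_bigr => u _ do rewrite !xeltE !minrep_set0 mulr1.
rewrite ffunE sumr_const.
rewrite mulf_eq0 => /predU1P[//|]; rewrite pnatr_eq0.
by move=> /eqP/card0_eq/(_ 1%g).
Qed.

(** If radical elements drop the filtration by [d], a product of [k] of them maps
    [1] into the line of [x_set0]; being killed by [x_set0] on the right through
    its last factor, it is zero. *)
Lemma radical_pow_eq0_filtration (B : {vspace galg W}) d k :
  1 \in B -> (B * B <= B)%VS -> (B <= descent_algebra S)%VS ->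
  (forall a j x, radical B a -> x \in G (d + j)%N -> a * x \in G j) ->
  (0 < k)%N -> (#|S| <= k * d)%N -> radical_pow_eq0 B k.
Proof.
move=> B1 BM sBS dropG k0 leS x radx.
have [c eqc] : exists c, \prod_(i < k) x i = c *: xelt S set0.
  apply: rank_filtration1; rewrite -[X in X \in _]mulr1.
  apply: (prod_rank_filtration (d := d)) => [i j u|]; first exact: dropG.
  by rewrite mem1_rank_filtration // addn1 ltnS.
suff px0 : \prod_(i < k) x i * xelt S set0 = 0.
  by rewrite eqc in px0 *; rewrite (xelt0_mul_eq0 px0) scale0r.
case: k k0 x radx {leS eqc} => // k _ x radx; rewrite big_ord_recr -mulrA.
have [xS _] := radx ord_max.
have [n xn0] := radical_nilpotent B1 BM (radx ord_max).
have -> : x ord_max * xelt S set0 = 0; last by rewrite mulr0.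
apply/rank_filtration0/(nilpotent_rank_filtration (subvP sBS _ xS) xn0).
by apply: mem_xspan; rewrite ?sub0set // cards0.
Qed.

End Solomon.

Lemma sigma0E (W : finGroupType) (S : {set W}) (a : galg W) :
  sigma0 S a = gelt (longest S) * a * gelt (longest S)^-1%g.
Proof.
rewrite lfunE /= /galg_map [in RHS](galg_sumE a) mulr_sumr mulr_suml.
by apply: eq_bigr => w _; rewrite !geltM -scalerAr -scalerAl.
Qed.

Lemma fixed_sigma0P (W : finGroupType) (S : {set W}) (a : galg W) :
  reflect (a * gelt (longest S) = gelt (longest S) * a)
          (a \in fixedSpace (sigma0 S)).
Proof.
apply: (iffP fixedSpaceP); rewrite sigma0E => eqa.
  by rewrite -{1}eqa -mulrA -geltM mulVg gelt1 mulr1.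
by rewrite -eqa -mulrA -geltM mulgV gelt1 mulr1.
Qed.

Theorem corollary5p3 (W : finGroupType) (S : {set W})
    (coxS : coxeter_system S) (S_neq0 : S != set0) :
  (exists LL : nat,
     loewy_length (descent_algebra S) LL /\ (LL <= #|S|)%N) /\
  (exists LL0 : nat,
     loewy_length (descent_algebra_fixed S) LL0 /\
     LL0%:R <= (#|S|%:R + 1) / 2 :> rat).
Proof.
have [eta [etaM etaS]] := exists_cocycle coxS.
have S_gt0 : (0 < #|S|)%N by rewrite card_gt0.
have D1 : 1 \in descent_algebra S := descent_algebra1 coxS etaM etaS.
have DM : (descent_algebra S * descent_algebra S <= descent_algebra S)%VS.
  by apply/prodvP=> a b aS bS; apply: (descent_algebraM coxS etaM etaS).
split.
  apply: loewy_length_le => //.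
  apply: (radical_pow_eq0_filtration coxS etaM etaS (d := 1)) => //; last first.
    by rewrite muln1.
  move=> a j x rada; have [n an0] := radical_nilpotent D1 DM rada.
  by apply: (nilpotent_rank_filtration coxS etaM etaS _ an0); case: rada.
have fixP (a : galg W) : reflect
    (a \in descent_algebra S /\ a * gelt (longest S) = gelt (longest S) * a)
    (a \in descent_algebra_fixed S).
  rewrite memv_cap; apply: (iffP andP) => -[aS]; first by move/fixed_sigma0P.
  by move=> aw; split=> //; apply/fixed_sigma0P.
have F1 : 1 \in descent_algebra_fixed S by apply/fixP; rewrite mul1r mulr1.
have FM : (descent_algebra_fixed S * descent_algebra_fixed S
           <= descent_algebra_fixed S)%VS.
  apply/prodvP=> a b /fixP[aS aw] /fixP[bS bw]; apply/fixP; split.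
    by rewrite (subvP DM) ?memv_mul.
  by rewrite -mulrA bw !mulrA aw.
(* [uphalf n] is the integer part of [(n + 1) / 2]. *)
have k_gt0 : (0 < uphalf #|S|)%N by rewrite uphalf_gt0.
have [|LL0 [lengthLL0 leLL0]] :=
    loewy_length_le (B := descent_algebra_fixed S) k_gt0.
  apply: (radical_pow_eq0_filtration coxS etaM etaS (d := 2)) => //.
  - exact: capvSl.
  - move=> a j x rada; have [n an0] := radical_nilpotent F1 FM rada.
    case: (rada) => /fixP[aS aw] _.
    exact: (commute_longest_rank_filtration coxS etaM etaS aS an0 aw).
  by rewrite muln2 -leq_uphalf_double.
exists LL0; split=> //.
rewrite ler_pdivlMr // -natrM -[X in _ + X]/(1%:R) -natrD ler_nat.
rewrite muln2 addn1; apply: leq_trans (_ : (uphalf #|S|).*2 <= _)%N.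
  by rewrite leq_double.
by rewrite uphalfE -[leqRHS]odd_double_half leq_addl.
Qed.
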